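(* Let $R_1\geq R_2\geq 1$ be integers and put $T=(R_1-R_2)/2$. Consider all triples $(r,(d,\underline{c}),\underline{a})$ where $r\in\mathcal{O}$ is monic with $|r|\le \widehat{R}_1\widehat{R}_2$; $d\in\mathcal{O}$ is monic with $d\mid r$ and $\underline{c}\in\mathcal{O}^2$ is primitive with $|dc_1|\le \widehat{T}|r|^{1/2}$, $|dc_2|<\widehat{T}^{-1}|r|^{1/2}$ and $\max\{\widehat{R}_1|dc_1^\bot|,\widehat{R}_2|dc_2^\bot|\}\ge |r|$; and $\underline{a}\in\mathcal{O}^2$ satisfies $|\underline{a}|<|r|$, $\gcd(a_1,a_2,r)=1$ and $\underline{a}/r\in L(d\underline{c})$. Then the rectangles $R(\underline{a}/r,|r|^{-1}\underline{\widehat{R}}^{-1})$ attached to distinct such triples are pairwise disjoint, and their union is $\mathbb{T}^2$.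
   Context: Let $q$ be a prime power, $K=\mathbb{F}_q(t)$, $\mathcal{O}=\mathbb{F}_q[t]$, $K_\infty=\mathbb{F}_q((t^{-1}))$ with absolute value $|\alpha|=q^N$ for $\alpha=\sum_{i\le N}\alpha_it^i$, $\alpha_N\ne0$ (so $|f|=q^{\deg f}$ on $\mathcal{O}$); vectors get the maximum norm. $\mathbb{T}=\{\alpha\in K_\infty:|\alpha|<1\}$. For real $R$, $\widehat{R}=q^R$. A vector $\underline{c}=(c_1,c_2)\in\mathcal{O}^2$ is primitive if $\gcd(c_1,c_2)=1$ and either $c_1$ is monic, or $c_1=0$ and $c_2$ is monic. Write $\underline{c}^\bot=(c_1^\bot,c_2^\bot)=(-c_2,c_1)$. For $d\in\mathcal{O}\setminus\{0\}$ and $\underline c$ primitive, the generalised line $L(d\underline{c})$ is the set of points $\underline{x}\in\mathbb{T}^2\cap K^2$ such that $d\underline{c}\cdot\underline{x}=k$ for some $k\in\mathcal{O}$ with $\gcd(k,d)=1$. For $\underline{x}\in\mathbb{T}^2$ and positive reals $\rho_1,\rho_2$, $R(\underline{x},(\rho_1,\rho_2))=\{\underline{\theta}\in\mathbb{T}^2:|\theta_i-x_i|<\rho_i,\ i=1,2\}$, and $|r|^{-1}\underline{\widehat{R}}^{-1}$ denotes $(|r|^{-1}\widehat{R}_1^{-1},|r|^{-1}\widehat{R}_2^{-1})$. *)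

(* Defs.v *)
From HB Require Import structures.
From mathcomp Require Import all_boot all_order all_algebra.
From mathcomp Require Import fraction.
From mathcomp Require Import boolp classical_sets fsbigop reals exp.
From mathcomp Require Import zify ring.

Set Implicit Arguments.
Unset Strict Implicit.
Unset Printing Implicit Defensive.

Import Order.TTheory GRing.Theory Num.Theory.
Local Open Scope classical_set_scope.
Local Open Scope ring_scope.

Notation "x %:F" := (tofrac x) : ring_scope.

(** * The field F((1/t)) *)

(* [x i] is the coefficient of t^i, so the support is bounded above. *)
Record laurent (F : fieldType) := Laurent {
  lcoef :> int -> F;
  lcoef_bounded : exists N : int, forall i, N < i -> lcoef i = 0 }.

HB.instance Definition _ (F : fieldType) := gen_eqMixin (laurent F).
HB.instance Definition _ (F : fieldType) := gen_choiceMixin (laurent F).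

Definition lbound (F : fieldType) (x : int -> F) (N : int) : Prop :=
  forall i, N < i -> x i = 0.

Lemma laurent_ext (F : fieldType) (x y : laurent F) : x =1 y -> x = y.
Proof.
case: x y => [x hx] [y hy] /= /funext e; subst y.
by congr Laurent; exact: Prop_irrelevance.
Qed.

Lemma lbound_le (F : fieldType) (x : int -> F) N M :
  N <= M -> lbound x N -> lbound x M.
Proof. by move=> NM xN i Mi; apply: xN; exact: le_lt_trans Mi. Qed.

Lemma lbound2 (F : fieldType) (x y : laurent F) :
  exists N, lbound x N /\ lbound y N.
Proof.
have [N xN] := lcoef_bounded x; have [M yM] := lcoef_bounded y.
exists (Order.max N M).
by split; [apply: lbound_le xN|apply: lbound_le yM]; rewrite le_max lexx ?orbT.
Qed.

Lemma laurent_ext_bound (F : fieldType) (N : int) (x y : laurent F) :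
  lbound x N -> lbound y N ->
  (forall k : nat, x (N - k%:Z) = y (N - k%:Z)) -> x = y.
Proof.
move=> xN yN e; apply: laurent_ext => i.
have [Ni|iN] := ltP N i; first by rewrite xN // yN.
have -> : i = N - (`|N - i|%N)%:Z by lia.
exact: e.
Qed.

(** ** Additive structure *)

Fact laurent0_bounded (F : fieldType) :
  exists N : int, lbound (fun=> 0 : F) N.
Proof. by exists 0. Qed.

Fact laurentD_bounded (F : fieldType) (x y : laurent F) :
  exists N : int, lbound (fun i => x i + y i) N.
Proof.
by have [N [xN yN]] := lbound2 x y; exists N => i Ni; rewrite xN // yN // addr0.
Qed.

Fact laurentN_bounded (F : fieldType) (x : laurent F) :
  exists N : int, lbound (fun i => - x i) N.
Proof.
by have [N xN] := lcoef_bounded x; exists N => i Ni; rewrite xN // oppr0.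
Qed.

Definition laurent0 (F : fieldType) : laurent F :=
  Laurent (laurent0_bounded F).
Definition laurentD (F : fieldType) (x y : laurent F) : laurent F :=
  Laurent (laurentD_bounded x y).
Definition laurentN (F : fieldType) (x : laurent F) : laurent F :=
  Laurent (laurentN_bounded x).

Fact laurentDA (F : fieldType) : associative (@laurentD F).
Proof. by move=> x y z; apply: laurent_ext => i /=; rewrite addrA. Qed.

Fact laurentDC (F : fieldType) : commutative (@laurentD F).
Proof. by move=> x y; apply: laurent_ext => i /=; rewrite addrC. Qed.

Fact laurent0D (F : fieldType) : left_id (laurent0 F) (@laurentD F).
Proof. by move=> x; apply: laurent_ext => i /=; rewrite add0r. Qed.

Fact laurentND (F : fieldType) :
  left_inverse (laurent0 F) (@laurentN F) (@laurentD F).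
Proof. by move=> x; apply: laurent_ext => i /=; rewrite addNr. Qed.

HB.instance Definition _ (F : fieldType) :=
  GRing.isZmodule.Build (laurent F)
    (@laurentDA F) (@laurentDC F) (@laurent0D F) (@laurentND F).

(** ** Multiplicative structure *)

(* Cauchy product; the sum has finite support because both supports are
   bounded above. *)
Definition laurent_conv (F : fieldType) (x y : int -> F) (n : int) : F :=
  \sum_(i \in [set: int]) (x i * y (n - i)).

(* The top B coefficients of a series bounded by N, as a polynomial in 1/t. *)
Definition ltrunc (F : fieldType) (x : int -> F) (N : int) (B : nat) : {poly F} :=
  \poly_(i < B) x (N - i%:Z).

Lemma laurent_convE (F : fieldType) (x y : int -> F) (N M : int) (k : nat) :
  lbound x N -> lbound y M ->
  laurent_conv x y (N + M - k%:Z) =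
  \sum_(j < k.+1) x (N - j%:Z) * y (M - (k - j)%N%:Z).
Proof.
move=> xN yM; rewrite /laurent_conv.
rewrite (@fsbigE _ _ _ _ setT [seq N - j%:Z | j : nat <- iota 0 k.+1]).
- under eq_bigl do rewrite in_setT.
  rewrite big_map -[iota _ _]/(index_iota 0 k.+1) big_mkord.
  by apply: eq_bigr => j _; congr (_ * y _); have := ltn_ord j; lia.
- by rewrite map_inj_uniq ?iota_uniq // => a b; lia.
- by [].
- move=> i _; apply: contraNeq => nz; have [Ni|iN] := ltP N i.
    by rewrite xN ?mul0r ?eqxx in nz.
  have [Mi|iM] := ltP M (N + M - k%:Z - i).
    by rewrite yM ?mulr0 ?eqxx in nz.
  apply/mapP; exists (`|N - i|%N); last by lia.
  by rewrite mem_iota; lia.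
Qed.

Lemma laurent_conv_trunc (F : fieldType) (x y : int -> F) (N M : int)
    (B k : nat) :
  lbound x N -> lbound y M -> (k < B)%N ->
  laurent_conv x y (N + M - k%:Z) = (ltrunc x N B * ltrunc y M B)`_k.
Proof.
move=> xN yM kB; rewrite laurent_convE // coefM; apply: eq_bigr => j _.
have jk := ltn_ord j; rewrite !coef_poly ifT ?ifT //; lia.
Qed.

Lemma lbound_conv (F : fieldType) (x y : int -> F) (N M : int) :
  lbound x N -> lbound y M -> lbound (laurent_conv x y) (N + M).
Proof.
move=> xN yM n NMn; rewrite /laurent_conv fsbig1 // => i _.
have [Ni|iN] := ltP N i; first by rewrite xN // mul0r.
by rewrite (yM (n - i)) ?mulr0 //; lia.
Qed.

Fact laurentM_bounded (F : fieldType) (x y : laurent F) :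
  exists N : int, lbound (laurent_conv x y) N.
Proof.
have [N xN] := lcoef_bounded x; have [M yM] := lcoef_bounded y.
by exists (N + M); exact: lbound_conv.
Qed.

Fact laurent1_bounded (F : fieldType) :
  exists N : int, lbound (fun i => (i == 0)%:R : F) N.
Proof. by exists 0 => i i0; rewrite gt_eqF. Qed.

Definition laurentM (F : fieldType) (x y : laurent F) : laurent F :=
  Laurent (laurentM_bounded x y).
Definition laurent1 (F : fieldType) : laurent F :=
  Laurent (laurent1_bounded F).

Lemma coefM_congr (F : fieldType) (p q p' q' : {poly F}) (k : nat) :
  (forall j, (j <= k)%N -> p`_j = p'`_j) ->
  (forall j, (j <= k)%N -> q`_j = q'`_j) -> (p * q)`_k = (p' * q')`_k.
Proof.
move=> pp qq; rewrite !coefM; apply: eq_bigr => j _.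
by have := ltn_ord j => jk; rewrite pp ?qq //; lia.
Qed.

Fact laurentMC (F : fieldType) : commutative (@laurentM F).
Proof.
move=> x y; have [N xN] := lcoef_bounded x; have [M yM] := lcoef_bounded y.
apply: (@laurent_ext_bound _ (N + M)).
- exact: lbound_conv.
- by rewrite addrC; exact: lbound_conv.
- move=> k /=; rewrite (@laurent_conv_trunc _ _ _ _ _ k.+1) // mulrC.
  by rewrite [N + M]addrC (@laurent_conv_trunc _ _ _ _ _ k.+1).
Qed.

Fact laurentMA (F : fieldType) : associative (@laurentM F).
Proof.
move=> x y z; have [N xN] := lcoef_bounded x; have [M yM] := lcoef_bounded y.
have [P zP] := lcoef_bounded z.
have xyB := lbound_conv xN yM; have yzB := lbound_conv yM zP.
apply: (@laurent_ext_bound _ (N + (M + P))).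
- exact: lbound_conv.
- by rewrite addrA; exact: lbound_conv.
- move=> k /=; rewrite (@laurent_conv_trunc _ _ _ _ _ k.+1) //.
  rewrite [N + (M + P)]addrA (@laurent_conv_trunc _ _ _ _ _ k.+1) //.
  transitivity ((ltrunc x N k.+1 * (ltrunc y M k.+1 * ltrunc z P k.+1))`_k).
    apply: coefM_congr => // j jk.
    by rewrite coef_poly ltnS jk; apply: laurent_conv_trunc.
  rewrite mulrA; apply: coefM_congr => // j jk.
  by rewrite coef_poly ltnS jk; apply/esym/laurent_conv_trunc.
Qed.

Fact laurent1M (F : fieldType) : left_id (laurent1 F) (@laurentM F).
Proof.
move=> x; have [N xN] := lcoef_bounded x.
have b1 : lbound (laurent1 F) 0 by move=> i i0 /=; rewrite gt_eqF.
apply: (@laurent_ext_bound _ N) => //.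
- by rewrite -[N]add0r; exact: lbound_conv.
- move=> k /=; rewrite -{1}[N]add0r laurent_convE // big_ord_recl /=.
  by rewrite mul1r subn0 big1 ?addr0 // => j _; rewrite mul0r.
Qed.

Fact laurentMDl (F : fieldType) :
  left_distributive (@laurentM F) (@laurentD F).
Proof.
move=> x y z; have [N [xN yN]] := lbound2 x y; have [M zM] := lcoef_bounded z.
have xyN : lbound (laurentD x y) N by move=> i Ni /=; rewrite xN // yN // addr0.
have xzB := lbound_conv xN zM; have yzB := lbound_conv yN zM.
apply: (@laurent_ext_bound _ (N + M)).
- exact: lbound_conv.
- by move=> i Ni /=; rewrite xzB // yzB // addr0.
- move=> k; rewrite /= !laurent_convE // -big_split /=.
  by apply: eq_bigr => j _; rewrite mulrDl.
Qed.

Fact laurent1_neq0 (F : fieldType) : laurent1 F != 0.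
Proof.
apply/eqP => /(congr1 (fun x : laurent F => x 0)) /= /eqP.
by rewrite oner_eq0.
Qed.

HB.instance Definition _ (F : fieldType) :=
  GRing.Zmodule_isComNzRing.Build (laurent F)
    (@laurentMA F) (@laurentMC F) (@laurent1M F) (@laurentMDl F)
    (@laurent1_neq0 F).

Lemma laurent_lead (F : fieldType) (x : laurent F) :
  x != 0 -> exists N, x N != 0 /\ lbound x N.
Proof.
move=> x0; have [N xN] := lcoef_bounded x.
have /existsNP[i /eqP xi] : ~ (forall i, x i = 0).
  by move=> e; move/eqP: x0; apply; exact: laurent_ext.
have exk : exists k : nat, x (N - k%:Z) != 0.
  exists `|N - i|%N; have [Ni|iN] := ltP N i; first by rewrite xN ?eqxx in xi.
  by have -> : N - (`|N - i|%N)%:Z = i by lia.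
exists (N - (ex_minn exk)%:Z); case: ex_minnP => k xk kmin; split=> // j kj.
have [Nj|jN] := ltP N j; first exact: xN.
apply/eqP; apply: contraT => xj.
have := kmin `|N - j|%N; have -> : N - (`|N - j|%N)%:Z = j by lia.
by move=> /(_ xj); lia.
Qed.

(* The coefficients of the inverse of the power series
   a 0 + a 1 u + a 2 u^2 + ..., by the usual recursion. *)
Fixpoint pinv_seq (F : fieldType) (a : nat -> F) (n : nat) : seq F :=
  if n is m.+1 then
    let b := pinv_seq a m in
    rcons b ((a 0%N)^-1 * ((m == 0%N)%:R - \sum_(j < m) a j.+1 * b`_(m - j.+1)))
  else [::].

Lemma pinv_exists (F : fieldType) (a : nat -> F) : a 0%N != 0 ->
  exists b : nat -> F,
    forall k, \sum_(j < k.+1) a j * b (k - j)%N = (k == 0%N)%:R.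
Proof.
move=> a0; have sz n : size (pinv_seq a n) = n.
  by elim: n => //= n IH; rewrite size_rcons IH.
have nthS n m i : (i < n)%N -> (n <= m)%N ->
    (pinv_seq a m)`_i = (pinv_seq a n)`_i.
  move=> ilt; elim: m => [|m IH]; first by lia.
  rewrite leq_eqVlt => /predU1P[-> //|nm].
  by rewrite /= nth_rcons sz ifT ?IH //; lia.
exists (fun n => (pinv_seq a n.+1)`_n) => k.
rewrite big_ord_recl subn0 [in X in X + _]/= nth_rcons sz ltnn eqxx.
rewrite mulrA divff // mul1r.
rewrite [X in _ + X](_ : _ = \sum_(j < k) a j.+1 * (pinv_seq a k)`_(k - j.+1)).
  by rewrite subrK.
apply: eq_bigr => j _; have jk := ltn_ord j; congr (_ * _).
by rewrite (@nthS (k - j.+1).+1 k) // /bump /=; lia.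
Qed.

Lemma laurentV_exists (F : fieldType) (x : laurent F) :
  x != 0 -> exists y : laurent F, y * x = 1.
Proof.
move=> /laurent_lead[N [xN0 xN]].
have [|b bE] := @pinv_exists F (fun k => x (N - k%:Z)); first by rewrite subr0.
pose y i := if i <= - N then b `|- N - i|%N else 0.
have yN : lbound y (- N) by move=> i Ni; rewrite /y leNgt Ni.
have yex : exists M, lbound y M by exists (- N).
exists (Laurent yex); rewrite mulrC; apply: (@laurent_ext_bound _ 0).
- by rewrite -(subrr N); exact: lbound_conv.
- by move=> i i0 /=; rewrite gt_eqF.
- move=> k; rewrite -[in LHS](subrr N) [LHS]/= laurent_convE //.
  rewrite [RHS]/= sub0r oppr_eq0 -[RHS](bE k); apply: eq_bigr => j _.
  rewrite /y ifT; last by lia.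
  by congr (_ * b _); lia.
Qed.

Definition laurentV (F : fieldType) (x : laurent F) : laurent F :=
  xget 0 [set y | y * x = 1].

Fact laurentVM (F : fieldType) (x : laurent F) : x != 0 -> laurentV x * x = 1.
Proof.
by move=> /laurentV_exists[y yx]; rewrite /laurentV; case: xgetP => // /(_ y).
Qed.

Fact laurentV0 (F : fieldType) : laurentV (0 : laurent F) = 0.
Proof.
rewrite /laurentV; case: xgetP => // y _ /= /esym/eqP.
by rewrite mulr0 oner_eq0.
Qed.

HB.instance Definition _ (F : fieldType) :=
  GRing.ComNzRing_isField.Build (laurent F) (@laurentVM F) (@laurentV0 F).

(** ** F[t] and F(t) as subrings of F((1/t)) *)

Definition poly_coef (F : fieldType) (p : {poly F}) (i : int) : F :=
  if i is Posz n then p`_n else 0.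

Fact poly_coef_bounded (F : fieldType) (p : {poly F}) :
  exists N : int, lbound (poly_coef p) N.
Proof.
exists (size p)%:Z => -[n|//]; rewrite ltz_nat => /ltnW; exact: nth_default.
Qed.

Definition ofO (F : fieldType) (p : {poly F}) : laurent F :=
  Laurent (poly_coef_bounded p).

Fact ofO_zmod_morphism (F : fieldType) : zmod_morphism (@ofO F).
Proof.
move=> p q; apply: laurent_ext => -[n|n] /=; first by rewrite coefB.
by rewrite subrr.
Qed.

Fact ofO_monoid_morphism (F : fieldType) : monoid_morphism (@ofO F).
Proof.
split=> [|p q]; first by apply: laurent_ext => -[n|n] //=; rewrite coef1.
apply: laurent_ext => -[n|n] /=; rewrite /laurent_conv; last first.
  rewrite fsbig1 // => -[i|i] _ /=; last by rewrite mul0r.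
  have -> : Negz n - i%:Z = Negz (n + i) by rewrite !NegzE; lia.
  by rewrite mulr0.
rewrite (@fsbigE _ _ _ _ setT [seq j%:Z | j : nat <- iota 0 n.+1]).
- under eq_bigl do rewrite in_setT.
  rewrite big_map -[iota _ _]/(index_iota 0 n.+1) big_mkord coefM.
  apply: eq_bigr => j _; have jn := ltn_ord j.
  by have -> : n%:Z - j%:Z = (n - j)%N%:Z by lia.
- by rewrite map_inj_uniq ?iota_uniq // => a b; lia.
- by [].
- move=> [i|i] _; apply: contraNeq => nz; last by rewrite mul0r eqxx in nz.
  apply/mapP; exists i => //; rewrite mem_iota /=.
  rewrite ltnS leqNgt; apply: contra nz => ni.
  have -> : n%:Z - i%:Z = Negz (i - n).-1 by rewrite NegzE; lia.
  by rewrite mulr0.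
Qed.

HB.instance Definition _ (F : fieldType) :=
  GRing.isZmodMorphism.Build {poly F} (laurent F) (@ofO F)
    (@ofO_zmod_morphism F).
HB.instance Definition _ (F : fieldType) :=
  GRing.isMonoidMorphism.Build {poly F} (laurent F) (@ofO F)
    (@ofO_monoid_morphism F).

Lemma ofO_inj (F : fieldType) : injective (@ofO F).
Proof.
move=> p q e; apply/polyP => n.
exact: (congr1 (fun x : laurent F => x n%:Z) e).
Qed.

Lemma ofO_eq0 (F : fieldType) (p : {poly F}) : (ofO p == 0) = (p == 0).
Proof. by rewrite -(rmorph0 (@ofO F)) (inj_eq (@ofO_inj F)). Qed.

Definition ofK (F : fieldType) (x : {fraction {poly F}}) : laurent F :=
  ofO \n_(repr x) / ofO \d_(repr x).

Lemma fraction_numden (A : idomainType) (x : {fraction A}) :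
  x = (\n_(repr x))%:F / (\d_(repr x))%:F.
Proof.
have mulE (r : {ratio A}) :
    (\pi_({fraction A})%qT r : {fraction A}) * (\d_r)%:F = (\n_r)%:F.
  have d0 := denom_ratioP r; unlock FracField.tofrac.
  rewrite -[LHS]FracField.pi_mul; apply/eqmodP.
  rewrite /= FracField.equivfE /FracField.mulf.
  by rewrite !numden_Ratio ?mulr1 ?oner_neq0 // mulrC.
have := mulE (repr x); rewrite reprK => <-.
by rewrite mulfK // tofrac_eq0 denom_ratioP.
Qed.

Lemma ofK_frac (F : fieldType) (n d : {poly F}) :
  d != 0 -> ofK (n%:F / d%:F) = ofO n / ofO d.
Proof.
move=> d0; set x := _ / _; have xE := fraction_numden x.
have e0 := denom_ratioP (repr x).
apply/eqP; rewrite /ofK eqr_div ?ofO_eq0 // -!rmorphM /=.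
rewrite (inj_eq (@ofO_inj F)) -tofrac_eq !tofracM -eqr_div ?tofrac_eq0 //.
by rewrite -xE.
Qed.

Lemma ofK_tofrac (F : fieldType) (p : {poly F}) : ofK p%:F = ofO p.
Proof.
by rewrite -[p%:F]divr1 -tofrac1 ofK_frac ?oner_neq0 // rmorph1 divr1.
Qed.

Fact ofK_zmod_morphism (F : fieldType) : zmod_morphism (@ofK F).
Proof.
move=> x y; rewrite [in LHS](fraction_numden x) [in LHS](fraction_numden y).
have dx := denom_ratioP (repr x); have dy := denom_ratioP (repr y).
rewrite -mulNr -tofracN addf_div ?tofrac_eq0 // -!tofracM -tofracD.
rewrite ofK_frac ?mulf_neq0 // rmorphD !rmorphM rmorphN /=.
by rewrite -addf_div ?ofO_eq0 // mulNr.
Qed.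

Fact ofK_monoid_morphism (F : fieldType) : monoid_morphism (@ofK F).
Proof.
split=> [|x y]; first by rewrite -tofrac1 ofK_tofrac rmorph1.
rewrite [in LHS](fraction_numden x) [in LHS](fraction_numden y).
have dx := denom_ratioP (repr x); have dy := denom_ratioP (repr y).
rewrite mulf_div -!tofracM ofK_frac ?mulf_neq0 // !rmorphM /=.
by rewrite -mulf_div.
Qed.

HB.instance Definition _ (F : fieldType) :=
  GRing.isZmodMorphism.Build {fraction {poly F}} (laurent F) (@ofK F)
    (@ofK_zmod_morphism F).
HB.instance Definition _ (F : fieldType) :=
  GRing.isMonoidMorphism.Build {fraction {poly F}} (laurent F) (@ofK F)
    (@ofK_monoid_morphism F).

(** ** Absolute value *)

Definition ldeg (F : fieldType) (x : laurent F) : int :=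
  xget 0 [set N | x N != 0 /\ lbound x N].

Definition absv (R : realType) (F : finFieldType) (x : laurent F) : R :=
  if x == 0 then 0 else #|F|%:R ^ ldeg x.

Definition absO (R : realType) (F : finFieldType) (p : {poly F}) : R :=
  absv R (ofO p).

Definition hat (R : realType) (F : finFieldType) (s : R) : R := #|F|%:R `^ s.

Lemma ldegE (F : fieldType) (x : laurent F) (N : int) :
  x N != 0 -> lbound x N -> ldeg x = N.
Proof.
move=> xN0 xN; rewrite /ldeg; case: xgetP => [M _ [/= xM0 xM]|/(_ N)[]//].
apply/eqP; rewrite eq_le; apply/andP; split; rewrite leNgt; apply/negP.
  by move=> /xN /eqP; apply/negP.
by move=> /xM /eqP; apply/negP.
Qed.

Lemma absOE (R : realType) (F : finFieldType) (p : {poly F}) :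
  absO R p = if p == 0 then 0 else #|F|%:R ^+ (size p).-1.
Proof.
rewrite /absO /absv ofO_eq0; case: ifPn => // p0.
rewrite (@ldegE _ _ (size p).-1) //; first by rewrite /= lead_coef_eq0.
move=> [n|//]; rewrite ltz_nat => pn /=; apply: nth_default.
by move: pn; case: (size p).
Qed.

(** * Lines and rectangles *)

Definition torus2 (R : realType) (F : finFieldType) :
    set (laurent F * laurent F) :=
  [set x | absv R x.1 < 1 /\ absv R x.2 < 1].

Arguments torus2 R F _ : clear implicits.

Definition primitive_vec (F : finFieldType) (c : {poly F} * {poly F}) : Prop :=
  coprimep c.1 c.2 /\ (c.1 \is monic \/ (c.1 = 0 /\ c.2 \is monic)).

Definition perp (F : finFieldType) (c : {poly F} * {poly F}) :
    {poly F} * {poly F} :=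
  (- c.2, c.1).

Definition ofK2 (F : finFieldType)
    (x : {fraction {poly F}} * {fraction {poly F}}) : laurent F * laurent F :=
  (ofK x.1, ofK x.2).

(* The generalised line L(d c). *)
Definition gline (R : realType) (F : finFieldType)
    (d : {poly F}) (c : {poly F} * {poly F}) :
    set ({fraction {poly F}} * {fraction {poly F}}) :=
  [set x | torus2 R F (ofK2 x) /\
    exists2 k : {poly F},
      (d * c.1)%:F * x.1 + (d * c.2)%:F * x.2 = k%:F & coprimep k d].

Definition rect (R : realType) (F : finFieldType)
    (x : laurent F * laurent F) (rho : R * R) : set (laurent F * laurent F) :=
  [set th | torus2 R F th /\
    absv R (th.1 - x.1) < rho.1 /\ absv R (th.2 - x.2) < rho.2].

Definition vdiv (F : finFieldType) (a : {poly F} * {poly F}) (r : {poly F}) :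
    {fraction {poly F}} * {fraction {poly F}} :=
  (a.1%:F / r%:F, a.2%:F / r%:F).

(* Triples (r, (d, c), a). *)
Definition triple (F : finFieldType) : Type :=
  {poly F} * ({poly F} * ({poly F} * {poly F})) * ({poly F} * {poly F}).

Definition admissible (R : realType) (F : finFieldType) (R1 R2 : int) :
    set (triple F) :=
  let T : R := (R1%:~R - R2%:~R) / 2 in
  [set t | let: (r, (d, c), a) := t in
    [/\ r \is monic & absO R r <= hat F R1%:~R * hat F R2%:~R] /\
    [/\ d \is monic, d %| r & primitive_vec c] /\
    [/\ absO R (d * c.1) <= hat F T * absO R r `^ (1 / 2),
        absO R (d * c.2) < (hat F T)^-1 * absO R r `^ (1 / 2) &
        Num.max (hat F R1%:~R * absO R (d * (perp c).1))
                (hat F R2%:~R * absO R (d * (perp c).2)) >= absO R r] /\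
    [/\ Num.max (absO R a.1) (absO R a.2) < absO R r,
        coprimep (gcdp a.1 a.2) r & gline R d c (vdiv a r)]].

Arguments admissible R F R1 R2 _ : clear implicits.

Definition triple_rect (R : realType) (F : finFieldType) (R1 R2 : int)
    (t : triple F) : set (laurent F * laurent F) :=
  let: (r, (d, c), a) := t in
  rect (ofK2 (vdiv a r))
    ((absO R r)^-1 * (hat F R1%:~R)^-1, (absO R r)^-1 * (hat F R2%:~R)^-1).

(* Main.v *)
(* Write deg r = n and let Lambda be the rank 2 lattice of (u, v) in O^2 with
   u a_1 + v a_2 = 0 mod r; it has index |r|, as gcd(a_1, a_2, r) = 1. The box
   deg u <= n/2 + T, deg v < n/2 - T contains a nonzero vector of Lambda by
   pigeonhole, and two such vectors have a determinant of degree < n divisible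
   by r, hence are proportional: a/r lies on exactly one line L(d c) of the
   prescribed size, with d c = (u, v).

   If theta is in the rectangles of (r, a) and (r', a') with |r'| <= |r|, then
   the vector r a' - r' a, turned by a right angle, lies in Lambda and is so
   short that its determinant with d c vanishes. It is thus a multiple of d c,
   and the max condition then forces it to be 0, so the fractions agree.

   Conversely, among the solutions of |r theta_i - a_i| < q^(-R_i), one with
   minimal |r| is admissible: its |r| is small enough by Dirichlet's theorem,
   and if the max condition failed, writing d c as such a turned vector
   r a' - r' a with |r'| < |r| would produce a smaller solution. *)

Require Import Defs.
From mathcomp Require Import all_boot all_order all_algebra.
From mathcomp Require Import boolp classical_sets reals.
From mathcomp Require Import fraction exp zify ring lra.

Set Implicit Arguments.
Unset Strict Implicit.
Unset Printing Implicit Defensive.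

Import Order.TTheory GRing.Theory Num.Theory.
Local Open Scope classical_set_scope.
Local Open Scope ring_scope.

(* [classical_sets] also exports an [lbound]. *)
Local Notation lbound := Defs.lbound.

(** * Generalised lines and the lattice attached to a rational point *)

Section Lattice.
Variable F : fieldType.
Implicit Types a p q r u v : {poly F}.

Lemma dvdp_coprime_pair a1 a2 r x : coprimep (gcdp a1 a2) r ->
  r %| x * a1 -> r %| x * a2 -> r %| x.
Proof.
move=> co h1 h2; have rg : coprimep r (gcdp a1 a2) by rewrite coprimep_sym.
rewrite -(Gauss_dvdpl x rg) (eqp_dvdr _ (mulp_gcdr _ _ _)).
by rewrite dvdp_gcd h1.
Qed.

Lemma bezout_triple a1 a2 r : coprimep (gcdp a1 a2) r ->
  exists x y z, x * a1 + y * a2 + z * r = 1.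
Proof.
move=> /Bezout_eq1_coprimepP[[s z] /= e].
have [[x y] /= exy] := Bezoutp a1 a2.
have /eqpP[[l m] /= /andP[l0 m0] E] := exy.
exists (s * (l / m)%:P * x), (s * (l / m)%:P * y), z; rewrite -e.
congr (_ + _); rewrite -!mulrA -mulrDr -mulrDr; congr (_ * _).
have -> : (l / m)%:P = m^-1%:P * l%:P by rewrite -polyCM mulrC.
by rewrite -mulrA !mul_polyC E scalerA mulVf // scale1r.
Qed.

Lemma monic_dvd_antisym p q : p \is monic -> q \is monic ->
  p %| q -> q %| p -> p = q.
Proof. by move=> pm qm pq qp; apply/eqP; rewrite -eqp_monic // /eqp pq. Qed.

(** Cramer's rule: the determinant times [a1], or times [a2], is a combination of the two linear
    forms, and [a1], [a2], [r] have no common factor. *)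
Lemma dvdp_det a1 a2 r u v u' v' : coprimep (gcdp a1 a2) r ->
  r %| u * a1 + v * a2 -> r %| u' * a1 + v' * a2 -> r %| u * v' - u' * v.
Proof.
move=> co h h'; apply: (dvdp_coprime_pair co).
  have -> : (u * v' - u' * v) * a1 =
    v' * (u * a1 + v * a2) - v * (u' * a1 + v' * a2) by ring.
  by rewrite dvdp_sub // dvdp_mull.
have -> : (u * v' - u' * v) * a2 =
  u * (u' * a1 + v' * a2) - u' * (u * a1 + v * a2) by ring.
by rewrite dvdp_sub // dvdp_mull.
Qed.

Lemma coprime_det0 u v c1 c2 : coprimep c1 c2 -> u * c2 = c1 * v ->
  exists e, u = e * c1 /\ v = e * c2.
Proof.
move=> /Bezout_eq1_coprimepP[[x y] /= b] E; exists (x * u + y * v).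
have Ex : u * (y * c2) = y * (c1 * v) by rewrite mulrCA E.
have Ey : x * (u * c2) = x * (c1 * v) by rewrite E.
split; [rewrite -[LHS]mulr1 -b|rewrite -[LHS]mulr1 -b].
  by rewrite mulrDr Ex; ring.
by rewrite !mulrDl -(mulrA x u) Ey; ring.
Qed.

(** Dividing [(u, v)] by its gcd and scaling gives the primitive [c]. Then [d] is r / gcd(r, c . a)
    made monic, the least multiplier putting d c into the lattice, and [k / d] is (c . a) / r in
    lowest terms. *)
Lemma exists_line a1 a2 r u v : r \is monic ->
  (u != 0) || (v != 0) -> r %| u * a1 + v * a2 ->
  exists e d c1 c2 k,
    [/\ e != 0, d \is monic, u = e * (d * c1) & v = e * (d * c2)] /\
    [/\ coprimep c1 c2, c1 \is monic \/ (c1 = 0 /\ c2 \is monic),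
        d * (c1 * a1 + c2 * a2) = k * r & coprimep k d].
Proof.
move=> rm uv0 ruv; set g := gcdp u v.
have g0 : g != 0 by rewrite gcdp_eq0 negb_and.
have [u0 uE] : exists w, u = w * g by apply/dvdpP; exact: dvdp_gcdl.
have [v0 vE] : exists w, v = w * g by apply/dvdpP; exact: dvdp_gcdr.
have co0 : coprimep u0 v0.
  have := coprimep_div_gcd uv0; rewrite -/g {1}uE {1}vE.
  by rewrite !mulpK.
(* Leading coefficient of the first nonzero coordinate, the one that must become monic. *)
pose l := if u0 == 0 then lead_coef v0 else lead_coef u0.
have l0 : l != 0.
  rewrite /l; case: (eqVneq u0 0) => [u00|]; rewrite lead_coef_eq0 //.
  by apply: contraL uv0 => /eqP v00; rewrite uE vE u00 v00 !mul0r eqxx.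
pose c1 := l^-1 *: u0; pose c2 := l^-1 *: v0.
have co : coprimep c1 c2 by rewrite coprimepZl ?coprimepZr ?invr_eq0.
have cm : c1 \is monic \/ (c1 = 0 /\ c2 \is monic).
  rewrite /c1 /c2 /l; case: (eqVneq u0 0) => [u00|u00].
    right; rewrite u00 scaler0; split=> //; move: l0; rewrite /l u00 eqxx => l0.
    by rewrite monicE lead_coefZ mulVf.
  by left; rewrite monicE lead_coefZ mulVf // lead_coef_eq0.
set x := c1 * a1 + c2 * a2.
have rx0 : (r != 0) || (x != 0) by rewrite monic_neq0.
set h := gcdp r x.
have h0 : h != 0 by rewrite gcdp_eq0 negb_and.
have [d0 rE] : exists w, r = w * h by apply/dvdpP; exact: dvdp_gcdl.
have [k0 xE] : exists w, x = w * h by apply/dvdpP; exact: dvdp_gcdr.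
have codk : coprimep d0 k0.
  have := coprimep_div_gcd rx0; rewrite -/h {1}rE {1}xE.
  by rewrite !mulpK.
have d00 : d0 != 0.
  by have := monic_neq0 rm; rewrite rE; apply: contraNneq => ->; rewrite mul0r.
pose m := lead_coef d0; have m0 : m != 0 by rewrite lead_coef_eq0.
(* Up to the unit [l], [g * x] is [u * a1 + v * a2], a multiple of [r]; cancelling [h] leaves
   [d0 %| g * k0], and [d0] is coprime to [k0]. *)
have d0g : d0 %| g.
  have : d0 * h %| (l *: (g * k0)) * h.
    rewrite -rE -scalerAl -mulrA -xE /x /c1 /c2 -!scalerAl -scalerDr -scalerAr.
    rewrite scalerA divff // scale1r mulrDr !mulrA [g * u0]mulrC [g * v0]mulrC.
    by rewrite -uE -vE.
  by rewrite dvdp_mul2r // dvdpZr // Gauss_dvdpl.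
have /dvdpP[e eE] := d0g.
exists ((l * m) *: e), (m^-1 *: d0), c1, c2, (m^-1 *: k0); split; split=> //.
- rewrite scaler_eq0 mulf_eq0 (negPf l0) (negPf m0) /=.
  by apply: contraNneq g0 => e0; rewrite eE e0 mul0r.
- by rewrite monicE lead_coefZ mulVf.
- rewrite /c1 -!mul_polyC polyCM.
  transitivity (l%:P * l^-1%:P * (m%:P * m^-1%:P) * (u0 * (e * d0)));
    last by ring.
  by rewrite -!polyCM !divff // !mul1r -eE.
- rewrite /c2 -!mul_polyC polyCM.
  transitivity (l%:P * l^-1%:P * (m%:P * m^-1%:P) * (v0 * (e * d0)));
    last by ring.
  by rewrite -!polyCM !divff // !mul1r -eE.
- by rewrite -/x xE rE -!scalerAl; congr (_ *: _); ring.
- by rewrite coprimepZl ?coprimepZr ?invr_eq0 // coprimep_sym.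
Qed.

(** A zero determinant makes the primitive vectors proportional, hence equal by normalisation. Then
    [d * k' = d' * k], and coprimality makes [d] and [d'] divide each other. *)
Lemma line_unique a1 a2 r d c1 c2 k d' c1' c2' k' :
  r \is monic -> d \is monic -> d' \is monic ->
  coprimep c1 c2 -> coprimep c1' c2' ->
  c1 \is monic \/ (c1 = 0 /\ c2 \is monic) ->
  c1' \is monic \/ (c1' = 0 /\ c2' \is monic) ->
  d * (c1 * a1 + c2 * a2) = k * r -> coprimep k d ->
  d' * (c1' * a1 + c2' * a2) = k' * r -> coprimep k' d' ->
  d * c1 * (d' * c2') - d' * c1' * (d * c2) = 0 ->
  [/\ d = d', c1 = c1' & c2 = c2'].
Proof.
move=> rm dm d'm co co' cm cm' E cok E' cok' D.
have D2 : c1 * c2' = c1' * c2.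
  apply/eqP; rewrite -subr_eq0; apply/eqP.
  apply: (mulfI (mulf_neq0 (monic_neq0 dm) (monic_neq0 d'm))).
  by rewrite mulr0 -[RHS]D; ring.
have cc' : c1 = c1' /\ c2 = c2'.
  have [e [e1 e2]] := coprime_det0 co' D2.
  have [f [f1 f2]] := coprime_det0 co (esym D2).
  have c0 : c1 != 0 \/ c1 = 0 /\ c2 != 0.
    by case: cm => [/monic_neq0|[? /monic_neq0]]; [left|right].
  have ef : e * f = 1.
    case: c0 => [c0|[_ c0]]; apply: (mulIf c0).
      by rewrite -mulrA -f1 -e1 mul1r.
    by rewrite -mulrA -f2 -e2 mul1r.
  suff : e = 1 by move=> e_1; rewrite e1 e2 e_1 !mul1r.
  have c1e : (c1 == 0) = (c1' == 0).
    apply/eqP/eqP => z; first by rewrite f1 z mulr0.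
    by rewrite e1 z mulr0.
  (* The first nonzero coordinate sits at the same place in both vectors and is monic in both, so
     their ratio [e] is monic. *)
  have em : e \is monic.
    case: cm => [cm|[c10 cm]]; case: cm' => [cm'|[c10' cm']].
    - by move: cm; rewrite e1 monicMr.
    - by have := monic_neq0 cm; rewrite c1e c10' eqxx.
    - by have := monic_neq0 cm'; rewrite -c1e c10 eqxx.
    - by move: cm; rewrite e2 monicMr.
  apply/eqP; rewrite -eqp_monic ?monic1 // -size_poly_eq1 -dvdp1 -ef.
  exact: dvdp_mulr.
case: cc' E' => <- <- E'; split=> //.
set x := c1 * a1 + c2 * a2 in E E'.
have dk : d * k' = d' * k.
  apply: (mulIf (monic_neq0 rm)); rewrite -!mulrA -E -E'; ring.
apply: monic_dvd_antisym => //.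
  rewrite -(Gauss_dvdpl _ (_ : coprimep d k)) -?dk ?dvdp_mulr //.
  by rewrite coprimep_sym.
by rewrite -(Gauss_dvdpl _ (_ : coprimep d' k')) ?dk ?dvdp_mulr // coprimep_sym.
Qed.

(** Modulo [r], the unknown [r'] must satisfy [r' * a1 = v] and [r' * a2 = - u]; the Bezout identity
    then leaves only the class of [x * v - y * u], and its remainder is smaller than [r]. *)
Lemma lattice_complement a1 a2 r u v : coprimep (gcdp a1 a2) r ->
  r != 0 -> r %| u * a1 + v * a2 ->
  exists r' a1' a2', [/\ (size r' < size r)%N,
    r * a1' - r' * a1 = - v & r * a2' - r' * a2 = u].
Proof.
move=> /bezout_triple[x [y [z b]]] r0 /dvdpP[k kE].
set s := x * v - y * u.
exists (s %% r), (- (s %/ r) * a1 - z * v - y * k),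
  (- (s %/ r) * a2 + z * u + x * k).
have sE : s %% r = s - s %/ r * r.
  by rewrite {2}(divp_eq s r) addrAC subrr add0r.
split; first by rewrite ltn_modp.
  rewrite sE; transitivity (- v * (x * a1 + y * a2 + z * r));
    last by rewrite b mulr1.
  have -> : r * (- (s %/ r) * a1 - z * v - y * k) =
    - r * (s %/ r) * a1 - r * z * v - y * (k * r) by ring.
  rewrite -kE /s; ring.
rewrite sE; transitivity (u * (x * a1 + y * a2 + z * r));
  last by rewrite b mulr1.
have -> : r * (- (s %/ r) * a2 + z * u + x * k) =
  - r * (s %/ r) * a2 + r * z * u + x * (k * r) by ring.
rewrite -kE /s; ring.
Qed.

End Lattice.

(** * Degree bounds for Laurent series and polynomials *)

Section Bound.
Variable F : fieldType.
Implicit Types (x y : laurent F) (p q r u v : {poly F}) (N M K : int).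

Lemma lboundB x y N : lbound x N -> lbound y N -> lbound (x - y) N.
Proof. by move=> xN yN i Ni /=; rewrite xN // yN // subr0. Qed.

Lemma lboundN x N : lbound x N -> lbound (- x) N.
Proof. by move=> xN i Ni /=; rewrite xN // oppr0. Qed.

Lemma lboundM x y N M : lbound x N -> lbound y M -> lbound (x * y) (N + M).
Proof. exact: lbound_conv. Qed.

Lemma lbound_ltM x y N M K :
  lbound x N -> lbound y M -> N + M <= K -> lbound (x * y) K.
Proof. by move=> xN yM h; apply: lbound_le h _; exact: lboundM. Qed.

Lemma lbound_ofO p (n : nat) : lbound (ofO p) (n%:Z - 1) <-> (size p <= n)%N.
Proof.
split=> [h|pn].
  by apply/leq_sizeP => j nj; have := h j%:Z; apply; lia.
by move=> [j|//] jn /=; apply/nth_default/(leq_trans pn); lia.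
Qed.

(* Degree of a polynomial, with the junk value [degp 0 = 0]. *)
Definition degp p : int := (size p).-1%:Z.

Lemma degp_ge0 p : 0 <= degp p. Proof. by []. Qed.

Lemma degpM p q : p != 0 -> q != 0 -> degp (p * q) = degp p + degp q.
Proof.
move=> p0 q0; rewrite /degp size_mul //.
move: p0 q0; rewrite -!size_poly_gt0.
by case: (size p) => // m _; case: (size q) => // n _; rewrite addnS -PoszD.
Qed.

Lemma ofO_lead_neq0 p : p != 0 -> ofO p (degp p) != 0.
Proof. by rewrite /degp /= lead_coef_eq0. Qed.

Lemma lbound_degp p : lbound (ofO p) (degp p).
Proof.
move=> [j|//]; rewrite /degp ltz_nat => jn /=; apply: nth_default.
exact: leq_trans (leqSpred _) jn.
Qed.

(** This is how determinants are shown to vanish: they are multiples of [r] of degree below that of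
    [r]. *)
Lemma dvdp_lbound_eq0 r p N : r %| p -> lbound (ofO p) N ->
  N < degp r -> p = 0.
Proof.
move=> rp pN Nr; apply/eqP; apply: contraT => p0.
have [/le_lt_trans/(_ Nr)|/pN/eqP] := leP (degp p) N.
  by rewrite /degp ltz_nat -!subn1 ltnNge leq_sub2r // dvdp_leq.
by rewrite (negPf (ofO_lead_neq0 p0)).
Qed.

Lemma lbound_det u v u' v' N M N' M' K :
  lbound (ofO u) N -> lbound (ofO v) M ->
  lbound (ofO u') N' -> lbound (ofO v') M' ->
  N + M' <= K -> N' + M <= K -> lbound (ofO (u * v' - u' * v)) K.
Proof.
move=> uN vM uN' vM' h h'; rewrite rmorphB !rmorphM.
by apply: lboundB; [exact: lbound_ltM h|exact: lbound_ltM h'].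
Qed.

Lemma coef_lead_mul x y N M :
  lbound x N -> lbound y M -> (x * y) (N + M) = x N * y M.
Proof.
move=> xN yM.
by rewrite -[N + M]subr0 [LHS](laurent_convE 0 xN yM) big_ord1 /= !subr0.
Qed.

(** Leading coefficients multiply to a nonzero coefficient, so the degrees of [x] and [y] add
    exactly. *)
Lemma lbound_cancel x y N M :
  x N != 0 -> lbound x N -> lbound (x * y) (N + M) -> lbound y M.
Proof.
move=> xN0 xN xyM; have [->//|/laurent_lead[L [yL0 yL]]] := eqVneq y 0.
apply: lbound_le (yL); rewrite leNgt; apply/negP => ML.
have := mulf_neq0 xN0 yL0; rewrite -(coef_lead_mul xN yL) => /eqP; apply.
by apply: xyM; rewrite ltrD2l.
Qed.

Lemma lbound_div_poly r x M : r != 0 ->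
  lbound (x / ofO r) (M - degp r) <-> lbound x M.
Proof.
move=> r0; have r0' : ofO r != 0 by rewrite ofO_eq0.
split=> h.
  have -> : x = ofO r * (x / ofO r) by rewrite mulrC divfK.
  by apply: (lbound_ltM (@lbound_degp r) h); lia.
apply: (lbound_cancel (ofO_lead_neq0 r0) (@lbound_degp r)).
rewrite mulrC divfK //; apply: lbound_le h; lia.
Qed.

Lemma lbound_mul_poly e p N : e != 0 ->
  lbound (ofO (e * p)) N -> lbound (ofO p) N.
Proof.
move=> e0 h; apply: (lbound_cancel (ofO_lead_neq0 e0) (@lbound_degp e)).
by rewrite -rmorphM; apply: lbound_le h; rewrite lerDr.
Qed.

End Bound.

(** * Absolute values as degree bounds *)

Section AbsoluteValue.
Variables (R : realType) (F : finFieldType).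
Implicit Types (x y : laurent F) (s : R) (N : int).

Let card_gt1 : 1 < #|F|%:R :> R.
Proof. by rewrite ltr1n card_finNzRing_gt1. Qed.

Lemma hatD s1 s2 : hat F (s1 + s2) = hat F s1 * hat F s2.
Proof. by rewrite /hat powRD // (gt_eqF (lt_trans ltr01 card_gt1)) implybT. Qed.

Lemma hatN s : hat F (- s) = (hat F s)^-1.
Proof. by rewrite /hat powRN. Qed.

Lemma hat_gt0 s : 0 < hat F s.
Proof. by rewrite powR_gt0 // (lt_trans ltr01). Qed.

Lemma ler_hat s1 s2 : (hat F s1 <= hat F s2) = (s1 <= s2).
Proof.
have lnF : 0 < ln (#|F|%:R : R) by rewrite ln_gt0.
by rewrite -ler_ln ?posrE ?hat_gt0 // !ln_powR ler_pM2r.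
Qed.

Lemma ltr_hat s1 s2 : (hat F s1 < hat F s2) = (s1 < s2).
Proof. by rewrite !ltNge ler_hat. Qed.

Lemma absv_lead x N : x N != 0 -> lbound x N -> absv R x = hat F N%:~R.
Proof.
move=> xN0 xN; rewrite /absv /hat ifF.
  by rewrite (ldegE xN0 xN) powR_intmul.
by apply: contraNF xN0 => /eqP ->.
Qed.

(** Nonzero absolute values are integral powers of the field size, so a weak bound with real
    exponent [s] only sees its floor [N]. This absorbs the half-integral exponents. *)
Lemma absv_le_hat x N s : N%:~R <= s < (N + 1)%:~R ->
  absv R x <= hat F s <-> lbound x N.
Proof.
move=> /andP[Ns sN]; have [->|/laurent_lead[L [xL0 xL]]] := eqVneq x 0.
  by rewrite /absv eqxx (ltW (hat_gt0 s)).
rewrite (absv_lead xL0 xL) ler_hat; split=> [Ls|xN].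
  apply: lbound_le xL; rewrite -ltzD1 -(ltr_int R).
  exact: le_lt_trans Ls sN.
apply: le_trans Ns; rewrite ler_int leNgt.
by apply: contra xL0 => /xN ->.
Qed.

(** A strict bound sees the ceiling [N] of [s] instead. *)
Lemma absv_lt_hat x N s : (N - 1)%:~R < s <= N%:~R ->
  absv R x < hat F s <-> lbound x (N - 1).
Proof.
move=> /andP[Ns sN]; have [->|/laurent_lead[L [xL0 xL]]] := eqVneq x 0.
  by rewrite /absv eqxx (hat_gt0 s).
rewrite (absv_lead xL0 xL) ltr_hat; split=> [Ls|xN].
  apply: lbound_le xL; rewrite -ltzD1 subrK -(ltr_int R).
  exact: lt_le_trans Ls sN.
apply: le_lt_trans Ns; rewrite ler_int leNgt.
by apply: contra xL0 => /xN ->.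
Qed.

Lemma absv_lt_hatz x N : absv R x < hat F N%:~R <-> lbound x (N - 1).
Proof. by apply: absv_lt_hat; rewrite lexx andbT ltr_int; lia. Qed.

Lemma absv_lt1 x : absv R x < 1 <-> lbound x (- 1).
Proof. by have := absv_lt_hatz x 0; rewrite sub0r /hat powRr0. Qed.

Lemma absO_hat (r : {poly F}) : r != 0 ->
  absO R r = hat F (degp r)%:~R.
Proof.
by move=> r0; apply: absv_lead (ofO_lead_neq0 r0) (@lbound_degp _ r).
Qed.

End AbsoluteValue.

(** * Dirichlet's theorem and short lattice vectors by counting *)

Section Pigeonhole.
Variable F : finFieldType.

(** With trivial kernel [f] would inject a set of q^m elements into one of q^n, where q is the field
    size. *)
Lemma exists_kernel (m n : nat) (f : 'rV[F]_m -> 'rV[F]_n) :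
  (n < m)%N -> {morph f : x y / x - y} -> exists2 x, x != 0 & f x = 0.
Proof.
move=> nm fB; apply: contrapT => /forall2NP H.
have f_inj : injective f.
  move=> x y fxy; apply/eqP; rewrite -subr_eq0; apply: contraT => xy0.
  by have [] := H (x - y); [rewrite xy0|rewrite fB fxy subrr].
have := leq_card f f_inj; rewrite !card_mx !mul1n.
rewrite leq_exp2l ?card_finNzRing_gt1 //.
by rewrite leqNgt nm.
Qed.

(** The [m1 + m2 + 1] coefficients of [r] face [m1 + m2] linear conditions: the first [m1],
    respectively [m2], coefficients of [r * th.1] and [r * th.2] after the polynomial part
    vanish. *)
Lemma dirichlet (th : laurent F * laurent F) (m1 m2 : nat) :
  exists2 r : {poly F}, r != 0 & (size r <= m1 + m2 + 1)%N /\
  exists a1 a2 : {poly F}, lbound (ofO r * th.1 - ofO a1) (- m1%:Z - 1) /\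
    lbound (ofO r * th.2 - ofO a2) (- m2%:Z - 1).
Proof.
pose tail (m : nat) (t : laurent F) (x : 'rV[F]_(m1 + m2 + 1)) : 'rV[F]_m :=
  \row_(i < m) (ofO (rVpoly x) * t) (- i%:Z - 1).
have tailB m t : {morph tail m t : x y / x - y}.
  by move=> x y; apply/rowP => i; rewrite !mxE !raddfB mulrBl.
have [||x x0 fx] := @exists_kernel (m1 + m2 + 1) (m1 + m2)
    (fun x => row_mx (tail m1 th.1 x) (tail m2 th.2 x)).
- by rewrite addn1.
- by move=> x y; rewrite !tailB opp_row_mx add_row_mx.
move: fx; rewrite -row_mx0 => /eq_row_mx[f1 f2].
exists (rVpoly x).
  by apply: contra x0 => /eqP e; rewrite -[x]rVpolyK e raddf0.
split; first exact: size_poly.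
have intpart (t : laurent F) (m : nat) : tail m t x = 0 ->
    exists a : {poly F}, lbound (ofO (rVpoly x) * t - ofO a) (- m%:Z - 1).
  set y := ofO _ * t => y0; have [N yN] := lcoef_bounded y.
  (* The polynomial part of [y]: no coefficient of index above [N] survives, so the truncation loses
     nothing. *)
  exists (\poly_(i < `|N|%N.+1) y i%:Z) => -[i|i] mi /=.
    rewrite coef_poly; case: ltnP => iN; first by rewrite subrr.
    by rewrite subr0; apply: yN; lia.
  have im : (i < m)%N by lia.
  have := congr1 (fun z : 'rV_m => z 0 (Ordinal im)) y0.
  by rewrite !mxE -/y subr0 => <-; congr (y _); rewrite NegzE /=; lia.
have [a1 h1] := intpart _ _ f1; have [a2 h2] := intpart _ _ f2.
by exists a1, a2.
Qed.

(** There are [X + 1] free coefficients for [u] and [degp r - X] for [v], one more than the [degp r]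
    coefficients of a residue modulo [r]. *)
Lemma short_lattice_vector (a1 a2 r : {poly F}) (X : int) : r != 0 -> 0 <= X ->
  exists u v, [/\ (u != 0) || (v != 0), r %| u * a1 + v * a2,
    lbound (ofO u) X & lbound (ofO v) (degp r - X - 1)].
Proof.
move=> r0 X0; have sr : (0 < size r)%N by rewrite size_poly_gt0.
(* When [degp r <= X] the bound on [v] is negative and forces [v = 0]; the vector [(r, 0)]
   serves. *)
have [nX|Xn] := leP (degp r) X.
  exists r, 0; split=> //; first by rewrite r0.
  - by rewrite mul0r addr0 dvdp_mulr.
  - by apply: lbound_le nX _; exact: lbound_degp.
  - by rewrite raddf0.
pose a := `|X|%N.+1; pose b := (`|degp r|.+1 - a)%N.
have [||x x0 fx] := @exists_kernel (a + b) `|degp r|%N (fun x =>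
  poly_rV ((rVpoly (lsubmx x) * a1 + rVpoly (rsubmx x) * a2) %% r)).
- by rewrite /b /a; lia.
- move=> x y; rewrite !raddfB /= !mulrBl -!raddfB /= -modpN -modpD.
  by congr (poly_rV (_ %% _)); ring.
exists (rVpoly (lsubmx x)), (rVpoly (rsubmx x)).
have szl : (size (rVpoly (lsubmx x)) <= a)%N by exact: size_poly.
have szr : (size (rVpoly (rsubmx x)) <= b)%N by exact: size_poly.
split.
- rewrite -negb_and; apply: contra x0 => /andP[/eqP l0 /eqP e0].
  by rewrite -[x]hsubmxK -[lsubmx x]rVpolyK -[rsubmx x]rVpolyK l0 e0
    !raddf0 row_mx0.
- rewrite /dvdp; move: fx => /(congr1 rVpoly); rewrite poly_rV_K; last first.
    by rewrite /degp /= -ltnS prednK // ltn_modpN0.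
  by move=> ->; rewrite raddf0.
- by apply: (@lbound_le _ _ (a%:Z - 1)); [rewrite /a; lia|apply/lbound_ofO].
- by apply: (@lbound_le _ _ (b%:Z - 1)); [rewrite /b /a; lia|apply/lbound_ofO].
Qed.

End Pigeonhole.

(** * Disjointness of the rectangles, in terms of degrees *)

Section Farey.
Variables (F : finFieldType) (R1 R2 : int).
Implicit Types (r d k : {poly F}) (a c : {poly F} * {poly F}).
Implicit Types (th : laurent F * laurent F).

(** The inequalities of the rectangle around [a / r], multiplied through by [r]. *)
Definition near th r a : Prop :=
  lbound (ofO r * th.1 - ofO a.1) (- R1 - 1) /\
  lbound (ofO r * th.2 - ofO a.2) (- R2 - 1).

(* The integer part of T + (deg r) / 2. *)
Definition tilt r : int := ((R1 - R2 + degp r) %/ 2)%Z.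

(* [admissible] in terms of degrees; an [lbound] below 0 makes a polynomial
   vanish, so zero entries need no separate treatment. *)
Definition farey r d c a : Prop :=
  [/\ r \is monic, degp r <= R1 + R2, d \is monic & primitive_vec c] /\
  [/\ lbound (ofO (d * c.1)) (tilt r),
      lbound (ofO (d * c.2)) (degp r - tilt r - 1) &
      ~ (lbound (ofO (d * c.2)) (degp r - R1 - 1) /\
         lbound (ofO (d * c.1)) (degp r - R2 - 1))] /\
  [/\ lbound (ofO a.1) (degp r - 1) /\ lbound (ofO a.2) (degp r - 1),
      coprimep (gcdp a.1 a.2) r &
      exists2 k, d * (c.1 * a.1 + c.2 * a.2) = k * r & coprimep k d].

Lemma tilt_bounds r : 2 * tilt r <= R1 - R2 + degp r < 2 * tilt r + 2.
Proof. by rewrite /tilt; lia. Qed.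

(** Eliminating [th] writes r a' - r' a as r' (r th - a) - r (r' th - a'), and [degp r' <= degp r]
    bounds both terms. *)
Lemma near_cross th r a r' a' : near th r a -> near th r' a' ->
  degp r' <= degp r ->
  lbound (ofO (r * a'.1 - r' * a.1)) (degp r - R1 - 1) /\
  lbound (ofO (r * a'.2 - r' * a.2)) (degp r - R2 - 1).
Proof.
have E (t : laurent F) p p' : ofO (r * p' - r' * p) =
    ofO r' * (ofO r * t - ofO p) - ofO r * (ofO r' * t - ofO p').
  by rewrite rmorphB !rmorphM /=; ring.
move=> [n1 n2] [n1' n2'] rr'; split.
  rewrite (E th.1); apply: lboundB.
    by apply: (lbound_ltM (@lbound_degp _ r') n1); lia.
  by apply: (lbound_ltM (@lbound_degp _ r) n1'); lia.
rewrite (E th.2); apply: lboundB.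
  by apply: (lbound_ltM (@lbound_degp _ r') n2); lia.
by apply: (lbound_ltM (@lbound_degp _ r) n2'); lia.
Qed.

Lemma near_proportional th r d c a r' a' : farey r d c a ->
  near th r a -> near th r' a' -> degp r' <= degp r ->
  r * a'.1 = r' * a.1 /\ r * a'.2 = r' * a.2.
Proof.
move=> [[rm rR dm [co cm]] [[du dv dmax] [_ coa [k kE cok]]]] na na' rr'.
have [] := near_cross na na' rr'.
set w1 := r * _ - _; set w2 := r * a'.2 - _ => b1 b2.
have rw : r %| w2 * a.1 + - w1 * a.2.
  apply/dvdpP; exists (a'.2 * a.1 - a'.1 * a.2); rewrite /w1 /w2; ring.
have ruv : r %| d * c.1 * a.1 + d * c.2 * a.2.
  by apply/dvdpP; exists k; rewrite -kE; ring.
have D0 : d * c.1 * - w1 - w2 * (d * c.2) = 0.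
  apply: (@dvdp_lbound_eq0 _ r _ (degp r - 1)).
  - exact: dvdp_det coa ruv rw.
  (* From [degp r <= R1 + R2] follow [tilt r <= R1] and [degp r - R2 <= tilt r], which keep both
     products of the determinant at degree at most [degp r - 1]. *)
  - have tb := tilt_bounds r.
    have b1N : lbound (ofO (- w1)) (degp r - R1 - 1).
      by rewrite raddfN; exact: lboundN.
    by apply: (lbound_det du dv b2 b1N); clear - tb rR; lia.
  - by rewrite ltrBlDr ltzD1.
have [e [e1 e2]] : exists e, w2 = e * c.1 /\ - w1 = e * c.2.
  apply: coprime_det0 co _; apply: (mulfI (monic_neq0 dm)).
  by apply/eqP; rewrite -subr_eq0 -oppr_eq0 -D0; apply/eqP; ring.
(* If [g * r] is the value of the linear form at [(w2, - w1)], comparison with the line equation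
   gives [e * k = g * d], and [d] is coprime to [k]. *)
have /dvdpP[f fE] : d %| e.
  rewrite -(Gauss_dvdpl e (_ : coprimep d k)) 1?coprimep_sym //.
  have /dvdpP[g gE] := rw; apply/dvdpP; exists g.
  apply: (mulIf (monic_neq0 rm)).
  rewrite -mulrA -kE -[RHS]mulrAC -gE e1 e2; ring.
have [f0|f0] := eqVneq f 0.
  move: e1 => /eqP; rewrite fE f0 !mul0r subr_eq0 => /eqP ->.
  by move: e2 => /eqP; rewrite fE f0 !mul0r oppr_eq0 subr_eq0 => /eqP ->.
(* For nonzero [f], the vector d c inherits the bounds of its multiple [(w2, - w1)], against the max
   condition. *)
case: dmax; split; apply: (lbound_mul_poly f0); rewrite mulrA -fE.
  by rewrite -e2 raddfN; apply: lboundN.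
by rewrite -e1.
Qed.

(** The bounds on the two coordinates add up to [degp r - 1], so the determinant of two such lattice
    vectors vanishes. *)
Lemma farey_same_numerators r d c d' c' a :
  farey r d c a -> farey r d' c' a -> d = d' /\ c = c'.
Proof.
move=> [[rm rR dm [co cm]] [[du dv _] [_ coa [k kE cok]]]].
move=> [[_ _ dm' [co' cm']] [[du' dv' _] [_ _ [k' kE' cok']]]].
suff D : d * c.1 * (d' * c'.2) - d' * c'.1 * (d * c.2) = 0.
  have [-> e1 e2] := line_unique rm dm dm' co co' cm cm' kE cok kE' cok' D.
  by rewrite [c]surjective_pairing e1 e2 -surjective_pairing.
apply: (@dvdp_lbound_eq0 _ r _ (degp r - 1)).
- apply: (dvdp_det coa); apply/dvdpP.
    by exists k; rewrite -kE; ring.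
  by exists k'; rewrite -kE'; ring.
- by apply: (lbound_det du dv du' dv'); clear; lia.
- by rewrite ltrBlDr ltzD1.
Qed.

Lemma farey_inj th r d c a r' d' c' a' :
  farey r d c a -> farey r' d' c' a' -> near th r a -> near th r' a' ->
  (r, (d, c), a) = (r', (d', c'), a').
Proof.
wlog rr' : r d c a r' d' c' a' / degp r' <= degp r.
  move=> H f f' n n'; have [h|h] := leP (degp r') (degp r).
    exact: H h _ _ _ _.
  by apply: esym; apply: H (ltW h) _ _ _ _.
move=> f f' n n'; have [e1 e2] := near_proportional f n n' rr'.
have [[rm _ _ _] [_ [_ coa _]]] := f; have [[rm' _ _ _] _] := f'.
have r0 := monic_neq0 rm; have r0' := monic_neq0 rm'.
(* Lowest terms give divisibility; the opposite order of degrees then makes the two monic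
   polynomials equal. *)
have rdvd : r %| r'.
  by apply: (dvdp_coprime_pair coa); rewrite -?e1 -?e2 dvdp_mulr.
have rE : r = r'.
  apply/eqP; rewrite -eqp_monic // -dvdp_size_eqp // eqn_leq dvdp_leq //=.
  by move: rr'; rewrite /degp lez_nat -ltnS !prednK ?size_poly_gt0.
have aE : a' = a.
  case: a a' e1 e2 {f f' n n' coa} => [a1 a2] [a1' a2'] /=; rewrite -rE.
  by move=> /(mulfI r0) -> /(mulfI r0) ->.
move: f'; rewrite -rE aE => f'.
by have [-> ->] := farey_same_numerators f f'.
Qed.

(** * Covering by an approximation with denominator of least degree *)

Lemma near_cancel th e r a : e != 0 ->
  near th (e * r) (e * a.1, e * a.2) -> near th r a.
Proof.
move=> e0 [h1 h2].
have E (t : laurent F) (p : {poly F}) :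
    ofO (e * r) * t - ofO (e * p) = ofO e * (ofO r * t - ofO p).
  by rewrite !rmorphM /=; ring.
rewrite E in h1; rewrite E in h2.
split; apply: (lbound_cancel (ofO_lead_neq0 e0) (@lbound_degp _ e)).
  by apply: lbound_le h1; rewrite lerDr.
by apply: lbound_le h2; rewrite lerDr.
Qed.

Hypotheses (hR2 : 1 <= R2) (hR12 : R2 <= R1).

Lemma exists_near th : exists r a, r != 0 /\ near th r a /\ degp r <= R1 + R2.
Proof.
have [r r0 [sr [a1 [a2 [h1 h2]]]]] := dirichlet th `|R1|%N `|R2|%N.
exists r, (a1, a2); split=> //; split.
  by split=> /=; [apply: lbound_le h1|apply: lbound_le h2]; lia.
suff : degp r <= (`|R1| + `|R2|)%N%:Z by lia.
by rewrite /degp lez_nat -ltnS prednK ?size_poly_gt0 // -addn1.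
Qed.

Lemma exists_minimal_near th : exists r a,
  [/\ r != 0, near th r a, degp r <= R1 + R2 &
      forall r' a', near th r' a' -> r' != 0 -> degp r <= degp r'].
Proof.
pose P n := `[< exists r a, [/\ r != 0, near th r a & degp r = n%:Z] >].
have exP : exists n, P n.
  have [r [a [r0 [na _]]]] := exists_near th.
  by exists (size r).-1; apply/asboolP; exists r, a.
have [n /asboolP[r [a [r0 na rn]]] nmin] := ex_minnP exP.
have rmin r' a' : near th r' a' -> r' != 0 -> degp r <= degp r'.
  move=> na' r0'; rewrite rn /degp lez_nat; apply: nmin.
  by apply/asboolP; exists r', a'.
exists r, a; split=> //; have [s [b [s0 [nb sR]]]] := exists_near th.
by apply: le_trans sR; exact: rmin nb s0.
Qed.

(** Cancelling a common factor of positive degree would contradict minimality; the leading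
    coefficient of [r] is scaled away first. *)
Lemma exists_reduced_near th : exists r a,
  [/\ r \is monic, near th r a, degp r <= R1 + R2 &
      coprimep (gcdp a.1 a.2) r] /\
  forall r' a', near th r' a' -> r' != 0 -> degp r <= degp r'.
Proof.
have [r [a [r0 na rR rmin]]] := exists_minimal_near th.
pose l := lead_coef r; have l0 : l%:P != 0 :> {poly F}.
  by rewrite polyC_eq0 lead_coef_eq0.
have lV : l%:P * l^-1%:P = 1 :> {poly F}.
  by rewrite -polyCM divff // lead_coef_eq0.
have cl : degp (l^-1%:P * r) = degp r.
  by rewrite /degp mul_polyC size_scale // invr_eq0 lead_coef_eq0.
have nl : near th (l^-1%:P * r) (l^-1%:P * a.1, l^-1%:P * a.2).
  by apply: (near_cancel l0); rewrite /= !mulrA lV !mul1r; case: (a) na.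
exists (l^-1%:P * r), (l^-1%:P * a.1, l^-1%:P * a.2).
rewrite cl; split=> //; split=> //.
  by rewrite mul_polyC monicE lead_coefZ mulVf // lead_coef_eq0.
set s := l^-1%:P * r in cl nl *; set b1 := l^-1%:P * a.1 in nl *.
set b2 := l^-1%:P * a.2 in nl *; rewrite /=.
have s0 : s != 0.
  by rewrite mulf_neq0 // polyC_eq0 invr_eq0 lead_coef_eq0.
rewrite /coprimep; set g := gcdp _ s.
have g0 : g != 0 by rewrite gcdp_eq0 negb_and s0 orbT.
have [s' sE] : exists w, s = w * g by apply/dvdpP; exact: dvdp_gcdr.
have gb : g %| gcdp b1 b2 by exact: dvdp_gcdl.
have [b1' b1E] : exists w, b1 = w * g.
  by apply/dvdpP; apply: dvdp_trans gb (dvdp_gcdl _ _).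
have [b2' b2E] : exists w, b2 = w * g.
  by apply/dvdpP; apply: dvdp_trans gb (dvdp_gcdr _ _).
have s0' : s' != 0 by apply: contraNneq s0 => e; rewrite sE e mul0r.
have ns' : near th s' (b1', b2').
  by apply: (near_cancel g0) => /=; rewrite ![g * _]mulrC -sE -b1E -b2E.
have := rmin _ _ ns' s0'; rewrite -cl sE [s' * g]mulrC degpM //.
rewrite -[leRHS]add0r lerD2r /degp lez_nat => h.
by rewrite eqn_leq size_poly_gt0 g0 andbT; move: h; case: (size g) => [|[]].
Qed.

Lemma exists_farey th : lbound th.1 (- 1) -> lbound th.2 (- 1) ->
  exists r d c a, farey r d c a /\ near th r a.
Proof.
move=> th1 th2; have [r [a [[rm na rR coa] rmin]]] := exists_reduced_near th.
have r0 := monic_neq0 rm; have tb := tilt_bounds r; have n0 := degp_ge0 r.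
have t0 : 0 <= tilt r by clear - tb n0 hR12; lia.
have [u [v [uv0 ruv uX vX]]] := short_lattice_vector a.1 a.2 r0 t0.
have [e [d [c1 [c2 [k [[e0 dm uE vE] [co cm kE cok]]]]]]] :=
  exists_line rm uv0 ruv.
have du : lbound (ofO (d * c1)) (tilt r).
  by apply: (lbound_mul_poly e0); rewrite -uE.
have dv : lbound (ofO (d * c2)) (degp r - tilt r - 1).
  by apply: (lbound_mul_poly e0); rewrite -vE.
exists r, d, (c1, c2), a; split=> //; split; first by split.
(* The numerator is r t - (r t - p), where [t] has degree below 0 and the error is small. *)
have ab (t : laurent F) (p : {poly F}) (N : int) : lbound t (- 1) -> 0 <= N ->
    lbound (ofO r * t - ofO p) (- N - 1) -> lbound (ofO p) (degp r - 1).
  move=> tb1 N0 h; rewrite -[ofO p](subKr (ofO r * t)); apply: lboundB.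
    by apply: (lbound_ltM (@lbound_degp _ r) tb1); clear; lia.
  by apply: lbound_le h; clear - N0 n0; lia.
split; last first.
  split=> //; last by exists k.
  by have [n1 n2] := na; split; [apply: (ab th.1 _ R1)|apply: (ab th.2 _ R2)];
    rewrite //; clear - hR2 hR12; lia.
split=> // -[bv bu].
have {}bv : lbound (ofO (d * c2)) (degp r - R1 - 1) by exact: bv.
have {}bu : lbound (ofO (d * c1)) (degp r - R2 - 1) by exact: bu.
have dr : r %| d * c1 * a.1 + d * c2 * a.2.
  by apply/dvdpP; exists k; rewrite -kE; ring.
have [r' [a1' [a2' [sr' e1 e2]]]] := lattice_complement coa r0 dr.
(* If [r' = 0], then [r] divides both coordinates of d c, whose degrees are below that of [r]; so d
   c = 0, impossible for [d] monic and [c] primitive. *)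
have r'0 : r' != 0.
  apply: contraNneq (monic_neq0 dm) => r'0.
  have c10 : d * c1 = 0.
    apply: (@dvdp_lbound_eq0 _ r _ _ _ bu); last by clear - hR2; lia.
    by rewrite -e2 r'0 mul0r subr0 dvdp_mulr.
  have c20 : d * c2 = 0.
    apply: (@dvdp_lbound_eq0 _ r _ _ _ bv); last by clear - hR2 hR12; lia.
    by rewrite -[d * c2]opprK -e1 r'0 mul0r subr0 dvdpNr dvdp_mulr.
  have /Bezout_eq1_coprimepP[[x y] /= b] := co.
  by rewrite -[d]mulr1 -b mulrDr mulrCA c10 mulrCA c20 !mulr0 addr0.
have rr' : degp r' < degp r.
  rewrite /degp ltz_nat -ltnS !prednK ?size_poly_gt0 //.
have n' : near th r' (a1', a2').
  have E (t : laurent F) (p p' w : {poly F}) : r * p' - r' * p = w ->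
      ofO r * (ofO r' * t - ofO p') = ofO r' * (ofO r * t - ofO p) - ofO w.
    by move=> <-; rewrite rmorphB !rmorphM /=; ring.
  (* By [E], [r] times the new error has degree at most [degp r - N - 1]; cancelling [r] leaves the
     bound required by [near]. *)
  have B (t : laurent F) (p p' w : {poly F}) (N : int) :
      r * p' - r' * p = w ->
      lbound (ofO r * t - ofO p) (- N - 1) -> lbound (ofO w) (degp r - N - 1) ->
      lbound (ofO r' * t - ofO p') (- N - 1).
    move=> wE h1 h2.
    apply: (lbound_cancel (ofO_lead_neq0 r0) (@lbound_degp _ r)).
    rewrite (E _ _ _ _ wE); apply: lboundB.
      by apply: (lbound_ltM (@lbound_degp _ r') h1); clear - rr'; lia.
    by apply: lbound_le h2; clear; lia.
  have [n1 n2] := na.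
  have bv' : lbound (ofO (- (d * c2))) (degp r - R1 - 1).
    by rewrite raddfN; exact: lboundN.
  split; first exact: (B th.1 a.1 a1' (- (d * c2)) R1 e1 n1 bv').
  exact: (B th.2 a.2 a2' (d * c1) R2 e2 n2 bu).
by have := rmin _ _ n' r'0; rewrite leNgt rr'.
Qed.

End Farey.

(** * From real inequalities to degrees *)

Section Translation.
Variables (R : realType) (F : finFieldType) (R1 R2 : int).
Implicit Types (r d k : {poly F}) (a c : {poly F} * {poly F}).

Let T : R := (R1%:~R - R2%:~R) / 2.

Lemma hat_mul_sqrt r s : r != 0 ->
  hat F s * absO R r `^ (1 / 2) = hat F (s + (degp r)%:~R / 2).
Proof. by move=> r0; rewrite absO_hat // hatD /hat -powRrM mul1r. Qed.

Lemma tilt_real r :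
  (tilt R1 R2 r)%:~R <= T + (degp r)%:~R / 2 < (tilt R1 R2 r + 1)%:~R.
Proof.
have /andP[h1 h2] := tilt_bounds R1 R2 r.
rewrite -(ler_int R) in h1; rewrite -(ltr_int R) in h2.
rewrite !(intrD, intrM, rmorphN) /= in h1 h2 *.
by rewrite /T; apply/andP; split; lra.
Qed.

Lemma absv_ofK_vdiv (p r : {poly F}) : r != 0 ->
  absv R (ofK (p%:F / r%:F)) < 1 <-> lbound (ofO p) (degp r - 1).
Proof.
move=> r0; rewrite absv_lt1 ofK_frac // -(lbound_div_poly (ofO p) _ r0).
by have -> : degp r - 1 - degp r = - 1 by ring.
Qed.

Lemma gline_vdiv r d c a : r != 0 ->
  lbound (ofO a.1) (degp r - 1) -> lbound (ofO a.2) (degp r - 1) ->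
  gline R d c (vdiv a r) <->
  exists2 k, d * (c.1 * a.1 + c.2 * a.2) = k * r & coprimep k d.
Proof.
move=> r0 a1 a2; have rF : r%:F != 0 by rewrite tofrac_eq0.
have E k : (d * c.1)%:F * (a.1%:F / r%:F) + (d * c.2)%:F * (a.2%:F / r%:F) =
    k%:F <-> d * (c.1 * a.1 + c.2 * a.2) = k * r.
  rewrite !mulrA -mulrDl -!tofracM -tofracD.
  have -> : d * c.1 * a.1 + d * c.2 * a.2 = d * (c.1 * a.1 + c.2 * a.2).
    by ring.
  split=> [/(congr1 ( *%R^~ r%:F))|->].
    by rewrite divfK // -tofracM => /eqP; rewrite tofrac_eq => /eqP.
  by rewrite tofracM mulfK.
split=> [[_ [k /E kE co]]|[k /E kE co]]; first by exists k.
by split; [split; apply/absv_ofK_vdiv|exists k].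
Qed.

(** As [perp] swaps the coordinates, [R1] governs [c.2] and [R2] governs [c.1]; the negated bounds
    are those of [near_cross] after a right-angle turn. *)
Lemma max_perp_ge r d c : r != 0 ->
  (Num.max (hat F R1%:~R * absO R (d * (perp c).1))
           (hat F R2%:~R * absO R (d * (perp c).2)) >= absO R r) <->
  ~ (lbound (ofO (d * c.2)) (degp r - R1 - 1) /\
     lbound (ofO (d * c.1)) (degp r - R2 - 1)).
Proof.
move=> r0.
have absN (p : {poly F}) : absO R (- p) = absO R p.
  by rewrite !absOE oppr_eq0 size_polyN.
have E (p : {poly F}) (N : int) : hat F N%:~R * absO R p < absO R r <->
    lbound (ofO p) (degp r - N - 1).
  rewrite -(absv_lt_hatz R) (absO_hat R r0) intrB hatD hatN.
  by rewrite mulrC -ltr_pdivlMr // hat_gt0.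
rewrite /perp /= mulrN absN leNgt gt_max.
rewrite -!E; split=> [/negP h [h1 h2]|h]; first by apply: h; rewrite h1.
by apply/negP => /andP[h1 h2]; apply: h.
Qed.

Lemma admissibleP r d c a :
  admissible R F R1 R2 (r, (d, c), a) <-> farey R1 R2 r d c a.
Proof.
rewrite /admissible /= /farey -/T.
have Tb := tilt_real r; set X := tilt R1 R2 r in Tb *.
have r0 : r \is monic -> r != 0 := @monic_neq0 _ r.
have Er : r != 0 -> absO R r <= hat F R1%:~R * hat F R2%:~R <->
    degp r <= R1 + R2.
  by move=> r_0; rewrite absO_hat // -hatD ler_hat -intrD ler_int.
have Eu : r != 0 -> absO R (d * c.1) <= hat F T * absO R r `^ (1 / 2) <->
    lbound (ofO (d * c.1)) X.
  by move=> r_0; rewrite hat_mul_sqrt //; exact: absv_le_hat.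
have Ev : r != 0 -> absO R (d * c.2) < (hat F T)^-1 * absO R r `^ (1 / 2) <->
    lbound (ofO (d * c.2)) (degp r - X - 1).
  (* The exponent is [degp r] minus the one in [Eu], so its ceiling is [degp r - X]. *)
  move=> r_0; rewrite -hatN hat_mul_sqrt //; apply: absv_lt_hat.
  move: Tb; rewrite !(intrD, rmorphN) /= => /andP[b1 b2].
  by apply/andP; split; lra.
have Ea : r != 0 -> Num.max (absO R a.1) (absO R a.2) < absO R r <->
    lbound (ofO a.1) (degp r - 1) /\ lbound (ofO a.2) (degp r - 1).
  move=> r_0; rewrite gt_max (absO_hat R r_0) -!(absv_lt_hatz R).
  by split=> [/andP//|[h1 h2]]; apply/andP.
split.
  move=> [[rm /(Er (r0 rm)) h1] [[dm _ cp]]].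
  move=> [[/(Eu (r0 rm)) h2 /(Ev (r0 rm)) h3]].
  move=> /(max_perp_ge _ _ (r0 rm)) h4 [/(Ea (r0 rm)) h5 co].
  by move=> /(gline_vdiv _ _ (r0 rm) h5.1 h5.2) h6.
move=> [[rm h1 dm cp] [[h2 h3 h4] [h5 co h6]]].
(* By the line equation [d] divides [k * r], and it is coprime to [k]. *)
have dr : d %| r.
  have [k kE cok] := h6; rewrite -(Gauss_dvdpr r (_ : coprimep d k)).
    by rewrite -kE dvdp_mulr.
  by rewrite coprimep_sym.
split; first by split=> //; apply/Er => //; exact: r0.
split; first by [].
split; first by split; [apply/Eu|apply/Ev|apply/max_perp_ge] => //; exact: r0.
split=> //; first by apply/Ea => //; exact: r0.
by apply/gline_vdiv => //; [exact: r0|exact: h5.1|exact: h5.2].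
Qed.

Lemma triple_rectP th r d c a : r != 0 ->
  triple_rect R R1 R2 (r, (d, c), a) th <->
  torus2 R F th /\ near R1 R2 th r a.
Proof.
move=> r0; rewrite /triple_rect /rect /=.
have E (t : laurent F) (p : {poly F}) (N : int) :
    absv R (t - ofK (p%:F / r%:F)) < (absO R r)^-1 * (hat F N%:~R)^-1 <->
    lbound (ofO r * t - ofO p) (- N - 1).
  have rO : ofO r != 0 by rewrite ofO_eq0.
  rewrite absO_hat // -!hatN -hatD -!(mulrNz 1) -intrD absv_lt_hatz ofK_frac //.
  rewrite -(lbound_div_poly (ofO r * t - ofO p) _ r0) mulrBl [ofO r * t]mulrC.
  by rewrite mulfK //; have -> : - degp r + - N - 1 = - N - 1 - degp r by ring.
by rewrite /near -!E.
Qed.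

End Translation.

Theorem theorem2p9 (R : realType) (F : finFieldType) (R1 R2 : int)
    (hR2 : 1 <= R2) (hR12 : R2 <= R1) :
  trivIset (admissible R F R1 R2) (triple_rect R R1 R2) /\
  \bigcup_(t in admissible R F R1 R2) triple_rect R R1 R2 t = torus2 R F.
Proof.
split.
  move=> [[r [d c]] a] [[r' [d' c']] a'] /admissibleP f /admissibleP f'.
  move=> [th [h h']].
  have [[rm _ _ _] _] := f; have [[rm' _ _ _] _] := f'.
  move: h h' => /(triple_rectP _ _ _ _ _ _ _ (monic_neq0 rm))[_ n].
  move=> /(triple_rectP _ _ _ _ _ _ _ (monic_neq0 rm'))[_ n'].
  exact: farey_inj f f' n n'.
apply/seteqP; split=> [th [[[r [d c]] a] /admissibleP f h]|th tth].
  have [[rm _ _ _] _] := f.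
  by move: h => /(triple_rectP _ _ _ _ _ _ _ (monic_neq0 rm))[].
have [t1 t2] := tth.
have [r [d [c [a [f n]]]]] := exists_farey hR2 hR12
  (proj1 (absv_lt1 R th.1) t1) (proj1 (absv_lt1 R th.2) t2).
have [[rm _ _ _] _] := f.
exists (r, (d, c), a); first exact/admissibleP.
by apply/triple_rectP => //; exact: monic_neq0.
Qed.
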